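(* Every S4 De Morgan spectral space $X$ is homeomorphic to $\mathcal{S}_0(\mathcal{A}_0(X))$, the prime spectrum of the algebra of compact open subsets of $X$.
   Context: For a topological space $X$, $\Omega(X)$ is the set of compact open subsets of $X$, and the specialization order is: $x\leqslant y$ iff every open set containing $x$ contains $y$. A spectral space is a compact, $T_0$, sober space $X$ such that $\Omega(X)$ is closed under finite intersections and is a basis for $X$ (sober: every completely prime filter of the lattice of open sets is the set of open neighbourhoods of some point). Given $g\colon X\to X$ and $R\subseteq X\times X$, for $U\subseteq X$ put $U^*=\{x\in X: g(x)\notin U\}$ and $\nabla_R U=R[U]=\{y\in X:\exists x\in U,\ xRy\}$. An S4 De Morgan spectral space is $\langle X;g,R,\tau\rangle$ such that: (1) $\langle X;\tau\rangle$ is a spectral space; (2) $g\colon X\to X$ is an order-inverting involution with respect to $\leqslant$, and $R$ is reflexive and transitive; (3) if $U\in\Omega(X)$ then $U^*,\nabla_RU\in\Omega(X)$; (4) if not $xRy$, there is $U\in\Omega(X)$ with $x\in U$ and $y\notin\nabla_RU$. Put $\mathcal{A}_0(X)=\langle\Omega(X);\cap,\cup,{}^*,\emptyset,X,\nabla_R\rangle$. For an algebra $\langle A;\wedge,\vee,-,0,1,\nabla\rangle$ of this type (bounded distributive lattice with two unary operations), $\mathcal{S}_0(A)=\langle\mathfrak{P}(A);g_A,R_A,\tau(\beta)\rangle$, where $\mathfrak{P}(A)$ is the set of prime (in particular proper) filters of $A$; $g_A(x)=\{a\in A:-a\notin x\}$; $xR_Ay$ iff for all $a\in A$, $a\in x$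 implies $\nabla a\in y$; and $\tau(\beta)$ is the topology with basis $\{\phi(a):a\in A\}$, $\phi(a)=\{x\in\mathfrak{P}(A):a\in x\}$. *)

(* Defs.v *)
From HB Require Import structures.
From mathcomp Require Import all_boot all_order.
From mathcomp Require Import boolp classical_sets topology.

Set Implicit Arguments.
Unset Strict Implicit.
Unset Printing Implicit Defensive.

Import Order.TTheory.
Local Open Scope classical_set_scope.

Section Spectral.
Context {X : topologicalType}.
Implicit Types (U V : set X) (x y : X).

Definition compact_open U := open U /\ compact U.

(* Larger points lie in more open sets; some authors use the opposite order. *)
Definition spec_le x y := forall U, open U -> U x -> U y.

(* The family [G] below may be empty, so that [set0] is never in [F]. *)
Record completely_prime_filter (F : set_system X) : Prop := {
  cpf_open : F `<=` open;
  cpf_setT : F setT;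
  cpf_setI : setI_closed F;
  cpf_up : forall U V, F U -> open V -> U `<=` V -> F V;
  cpf_bigcup : forall G : set_system X, G `<=` open ->
    F (\bigcup_(U in G) U) -> exists2 U, G U & F U }.

Definition sober_space := forall F : set_system X,
  completely_prime_filter F -> exists x, F = open_nbhs x.

End Spectral.
Arguments sober_space : clear implicits.

HB.mixin Record isSpectral X & Topological X := {
  spectral_compact : compact [set: X];
  spectral_T0 : kolmogorov_space X;
  spectral_sober : sober_space X;
  spectral_setI : setI_closed (@compact_open X);
  spectral_basis : basis (@compact_open X) }.

#[short(type="spectralType")]
HB.structure Definition Spectral := {X of Topological X & isSpectral X}.

Definition dm_compl {X : Type} (g : X -> X) (U : set X) : set X :=
  [set x | ~ U (g x)].

Definition rel_image {X : Type} (R : X -> X -> Prop) (U : set X) : set X :=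
  [set y | exists2 x, U x & R x y].

HB.mixin Record isS4DMSpectral X & Spectral X := {
  dm_inv : X -> X;
  s4_rel : X -> X -> Prop;
  dm_inv_anti : forall x y : X, spec_le x y -> spec_le (dm_inv y) (dm_inv x);
  dm_invK : involutive dm_inv;
  s4_rel_refl : forall x, s4_rel x x;
  s4_rel_trans : forall x y z, s4_rel x y -> s4_rel y z -> s4_rel x z;
  compact_open_compl : forall U : set X,
    compact_open U -> compact_open (dm_compl dm_inv U);
  compact_open_rel_image : forall U : set X,
    compact_open U -> compact_open (rel_image s4_rel U);
  s4_rel_sep : forall x y : X, ~ s4_rel x y ->
    exists U : set X, [/\ compact_open U, U x & ~ rel_image s4_rel U y] }.

#[short(type="s4dmSpectralType")]
HB.structure Definition S4DMSpectral := {X of Spectral X & isS4DMSpectral X}.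

HB.mixin Record hasNegNabla (d : Order.disp_t) A & Order.TBDistrLattice d A := {
  neg : A -> A;
  nabla : A -> A }.

#[short(type="negNablaLatticeType")]
HB.structure Definition NegNablaLattice d :=
  {A of Order.TBDistrLattice d A & hasNegNabla d A}.

Record prime_filter d (A : tbDistrLatticeType d) (F : set A) : Prop := {
  pf_top : F \top%O;
  pf_meet : forall a b, F a -> F b -> F (a `&` b)%O;
  pf_up : forall a b, F a -> (a <= b)%O -> F b;
  pf_bot : ~ F \bot%O;
  pf_join : forall a b, F (a `|` b)%O -> F a \/ F b }.

Record primeFilter d (A : tbDistrLatticeType d) := PrimeFilter {
  pf_set :> set A;
  pf_prime : prime_filter pf_set }.

HB.instance Definition _ d (A : tbDistrLatticeType d) :=
  gen_eqMixin (primeFilter A).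
HB.instance Definition _ d (A : tbDistrLatticeType d) :=
  gen_choiceMixin (primeFilter A).

Definition pf_basic d (A : tbDistrLatticeType d) (a : A) :
  set (primeFilter A) := [set x | pf_set x a].

Section PrimeSpectrumTopology.
Context d (A : tbDistrLatticeType d).

Let pf_basic_cover :
  \bigcup_(B in range (@pf_basic d A)) B = [set: primeFilter A].
Proof.
rewrite -subTset => x _; exists (pf_basic \top%O); first by exists \top%O.
exact: pf_top (pf_prime x).
Qed.

Let pf_basic_join (B C : set (primeFilter A)) (x : primeFilter A) :
  range (@pf_basic d A) B -> range (@pf_basic d A) C -> B x -> C x ->
  exists D, [/\ range (@pf_basic d A) D, D x & D `<=` B `&` C].
Proof.
move=> [a _ <-] [b _ <-] xa xb; exists (pf_basic (a `&` b)%O); split.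
- by exists (a `&` b)%O.
- exact: pf_meet (pf_prime x) _ _ xa xb.
- move=> y yab; split; apply: (pf_up (pf_prime y) yab).
  + exact: leIl.
  + exact: leIr.
Qed.

HB.instance Definition _ :=
  isBaseTopological.Build (primeFilter A) pf_basic_cover pf_basic_join.

End PrimeSpectrumTopology.

Section PrimeSpectrumStructure.
Context d (A : negNablaLatticeType d).

(* For an arbitrary [A] this is only a set of elements of [A]; that it is again
   a prime filter depends on the De Morgan laws. *)
Definition spectrum_inv (x : primeFilter A) : set A :=
  [set a | ~ pf_set x (neg a)].

Definition spectrum_rel (x y : primeFilter A) : Prop :=
  forall a : A, pf_set x a -> pf_set y (nabla a).

End PrimeSpectrumStructure.

Definition compact_openb {X : topologicalType} : pred (set X) :=
  fun U => `[< compact_open U >].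

Record compactOpen (X : topologicalType) := CompactOpen {
  co_set :> set X;
  co_setP : compact_openb co_set }.

HB.instance Definition _ (X : topologicalType) := [isSub for @co_set X].
HB.instance Definition _ (X : topologicalType) :=
  [Choice of compactOpen X by <:].

Section CompactOpenLattice.
Context (X : spectralType).

Let compact_openbI : {in @compact_openb X &, forall U V,
  (U `&` V)%O \in @compact_openb X}.
Proof.
by move=> U V /asboolP cU /asboolP cV; apply/asboolP; exact: spectral_setI.
Qed.

Let compact_openbU : {in @compact_openb X &, forall U V,
  (U `|` V)%O \in @compact_openb X}.
Proof.
move=> U V /asboolP[oU cU] /asboolP[oV cV]; apply/asboolP; split.
- exact: openU.
- exact: compactU.
Qed.

Let compact_openb0 : (\bot%O : set X) \in @compact_openb X.
Proof. by apply/asboolP; split; [exact: open0|exact: compact0]. Qed.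

Let compact_openb1 : (\top%O : set X) \in @compact_openb X.
Proof. by apply/asboolP; split; [exact: openT|exact: spectral_compact]. Qed.

HB.instance Definition _ := Order.isTBLatticeClosed.Build
  set_display (set X) (@compact_openb X)
  compact_openbI compact_openbU compact_openb0 compact_openb1.

HB.instance Definition _ :=
  [SubChoice_isTBSubLattice of compactOpen X by <: with set_display].

Let compactOpen_meetUl :
  @left_distributive (compactOpen X) (compactOpen X) Order.meet Order.join.
Proof.
by move=> U V W; apply: val_inj; exact: setIUl.
Qed.

HB.instance Definition _ := Order.Lattice_Meet_isDistrLattice.Build
  set_display (compactOpen X) compactOpen_meetUl.

End CompactOpenLattice.

Section CompactOpenAlgebra.
Context (X : s4dmSpectralType).

Fact co_neg_subproof (U : compactOpen X) :
  compact_openb (dm_compl (@dm_inv X) U).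
Proof.
by have /asboolP cU := co_setP U; apply/asboolP; exact: compact_open_compl.
Qed.

Fact co_nabla_subproof (U : compactOpen X) :
  compact_openb (rel_image (@s4_rel X) U).
Proof.
by have /asboolP cU := co_setP U; apply/asboolP; exact: compact_open_rel_image.
Qed.

Definition co_neg (U : compactOpen X) : compactOpen X :=
  CompactOpen (co_neg_subproof U).

Definition co_nabla (U : compactOpen X) : compactOpen X :=
  CompactOpen (co_nabla_subproof U).

HB.instance Definition _ :=
  hasNegNabla.Build set_display (compactOpen X) co_neg co_nabla.

End CompactOpenAlgebra.

Definition homeomorphism {X Y : topologicalType} (f : X -> Y) :=
  exists h : Y -> X,
    [/\ cancel f h, cancel h f, continuous f & continuous h].

(* Main.v *)
(** A prime filter [P] of compact opens generates the set of opens containing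
    some member of [P]. If a union of opens contains [U] in [P], then by
    compactness [U] is covered by finitely many compact opens, each inside a
    member of the union, and primality puts one of them in [P]; so the
    generated filter is completely prime and sobriety makes it the filter of
    open neighbourhoods of a point. *)
Require Import Defs.
From mathcomp Require Import all_boot all_order.
From mathcomp Require Import finmap boolp classical_sets topology.

Set Implicit Arguments.
Unset Strict Implicit.
Unset Printing Implicit Defensive.

Import Order.TTheory.
Local Open Scope classical_set_scope.

Lemma homeomorphism_bij (X Y : topologicalType) (f : X -> Y) :
  injective f -> (forall y, exists x, f x = y) -> continuous f ->
  (forall U, open U -> open (f @` U)) -> homeomorphism f.
Proof.
move=> f_inj f_surj f_cont f_open.
have [h fh] := choice f_surj.
have hf : cancel f h by move=> x; apply: f_inj; rewrite fh.
exists h; split=> //; apply/continuousP => U oU.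
suff -> : h @^-1` U = f @` U by exact: f_open.
apply/seteqP; split=> [y Uhy | _ [x Ux <-]]; first by exists (h y).
by rewrite /preimage /= hf.
Qed.

(* [compact_cover] gives this for pointed spaces only; a spectral space may be
   empty. *)
Lemma compact_cover_compact (X : topologicalType) (A : set X) :
  compact A -> cover_compact A.
Proof.
move=> /compact_near_coveringP Acov I D f f_open AD.
(* [F] is the filter of eventually large finite index sets, based at the finite subsets of [D].
   Near-covering compactness along [F] turns one index per point into a single finite set that
   covers all of [A]. *)
pose B (s : {fset I}) := [set t : {fset I} | (s `<=` t)%fset].
pose F := filter_from [set s : {fset I} | {subset s <= D}] B.
have F_filter : Filter F.
  apply: filter_from_filter => [|s t sD tD]; first by exists fset0.
  exists (s `|` t)%fset; first by move=> i /fsetUP [/sD|/tD].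
  by move=> u; rewrite /B /= fsubUset => /andP.
case: (Acov _ F (fun s x => exists2 i, i \in s & f i x)) => [x /AD [i Di fix_]|].
  exists (f i, B [fset i]%fset) => /=.
    split; first by apply: open_nbhs_nbhs; split=> //; exact: f_open.
    by exists [fset i]%fset => // j /fset1P ->; exact: mem_set.
  move=> [y s] /= [fiy]; rewrite /B /= fsub1set => si.
  by exists i.
move=> s sD /(_ s) As; exists s => // x /As; apply.
exact: fsubset_refl.
Qed.

Lemma prime_filter_bigjoin d (A : tbDistrLatticeType d) (F : set A)
    (s : seq A) :
  prime_filter F -> F (\join_(a <- s) a)%O -> exists2 a, a \in s & F a.
Proof.
move=> Fp; elim: s => [|a s IHs]; first by rewrite big_nil => /(pf_bot Fp).
rewrite big_cons => /(pf_join Fp) [Fa | /IHs [b bs Fb]].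
- by exists a; rewrite ?mem_head.
- by exists b; rewrite // in_cons bs orbT.
Qed.

Lemma primeFilter_inj d (A : tbDistrLatticeType d) (P Q : primeFilter A) :
  pf_set P = pf_set Q -> P = Q.
Proof.
case: P Q => [F Fp] [G Gp] /= FG.
by case: _ / FG Gp => Gp; congr PrimeFilter; exact: Prop_irrelevance.
Qed.

Section PrimeSpectrum.
Context d (A : tbDistrLatticeType d).

Lemma open_pf_basic (a : A) : open (pf_basic a).
Proof.
(* Open sets here are by construction unions of families of basic sets; a singleton family
   suffices. *)
exists [set pf_basic a]; first by move=> _ ->; exists a.
by rewrite bigcup_set1.
Qed.

Lemma open_primeFilterP (B : set (primeFilter A)) (P : primeFilter A) :
  open B -> B P -> exists2 a, pf_set P a & pf_basic a `<=` B.
Proof.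
move=> [D Dbasic <-] [C DC CP]; have [a _ aC] := Dbasic _ DC.
exists a; first by rewrite -aC in CP.
by rewrite aC => Q CQ; exists C.
Qed.

End PrimeSpectrum.

Section SpectralPoints.
Context {X : spectralType}.
Implicit Types (U V W : compactOpen X) (x y : X).

Lemma leEcompactOpen U V : (U <= V)%O = (co_set U `<=` co_set V) :> Prop.
Proof. exact: subsetEset. Qed.

Lemma compactOpen_open U : open (co_set U).
Proof. by have /asboolP [] := co_setP U. Qed.

Lemma compactOpen_compact U : compact (co_set U).
Proof. by have /asboolP [] := co_setP U. Qed.

Lemma compactOpen_basis (V : set X) x : open V -> V x ->
  exists2 U : compactOpen X, co_set U x & co_set U `<=` V.
Proof.
move=> oV Vx; have [_ /(_ x V)] := @spectral_basis X.
case=> [|U [cU Ux] UV]; first exact: open_nbhs_nbhs.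
by exists (CompactOpen (introT (asboolP _) cU)).
Qed.

Lemma compactOpen_neighbourhoods_prime x :
  prime_filter [set U : compactOpen X | co_set U x].
Proof.
by split=> //= U V Ux; rewrite leEcompactOpen; apply.
Qed.

Definition spectral_point x : primeFilter (compactOpen X) :=
  PrimeFilter (compactOpen_neighbourhoods_prime x).

(** A neighbourhood separating two points by T0 shrinks to a compact open one, which then lies in
    exactly one of the two filters. *)
Lemma spectral_point_inj : injective spectral_point.
Proof.
move=> x y xy; have xyE U : co_set U x = co_set U y.
  by have := congr1 (fun P => pf_set P U) xy.
apply: contrapT => /eqP /(@spectral_T0 X) [B [] []];
  rewrite !inE nbhsE => -[V [oV Vz] VB]; have [U Uz UV] := compactOpen_basis oV Vz;
  by apply; apply/VB/UV; rewrite ?xyE // -xyE.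
Qed.

Lemma prime_filter_completely_prime (P : primeFilter (compactOpen X)) :
  completely_prime_filter
    [set V : set X | open V /\ exists2 U, pf_set P U & co_set U `<=` V].
Proof.
have Pp := pf_prime P; split=> [V [] //|||V W [oV [U PU UV]] oW VW|G Go].
- by split; [exact: openT|exists \top%O => //; exact: pf_top Pp].
- move=> V W [oV [U PU UV]] [oW [U' PU' UW]]; split; first exact: openI.
  exists (U `&` U')%O; first exact: (pf_meet Pp).
  by move=> x [/UV Vx /UW Wx].
- by split=> //; exists U => //; exact: subset_trans VW.
move=> [_ [U PU UG]]; have := compact_cover_compact (@compactOpen_compact U).
(* Members of [G] need not be compact, so they may not be lattice elements. Covering [U] by compact
   opens that refine [G] makes the finite union a join to which primality applies. *)
move=> /(_ _ [set W : compactOpen X | exists2 V, G V & co_set W `<=` V]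
  (@co_set X)).
case=> [W _|x /UG [V GV Vx]|s sG Us]; first exact: compactOpen_open.
  have [W Wx WV] := compactOpen_basis (Go _ GV) Vx.
  by exists W => //; exists V.
have : pf_set P (\join_(W <- s) W)%O.
  apply: (pf_up Pp PU); rewrite leEcompactOpen => x /Us [W Ws].
  have := @joins_sup_seq _ _ _ s xpredT id W Ws isT.
  by rewrite leEcompactOpen; apply.
move=> /(prime_filter_bigjoin Pp) [W Ws PW].
have [V GV WV] := set_mem (sG _ Ws).
by exists V => //; split; [exact: Go|exists W].
Qed.

(** Passing to the generated filter of opens loses nothing: a compact open set that contains a
    member of [P] is itself in [P] by upward closure. So the point given by sobriety has exactly [P]
    as its compact open neighbourhoods. *)
Lemma spectral_point_surj (P : primeFilter (compactOpen X)) :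
  exists x, spectral_point x = P.
Proof.
have [x Px] := spectral_sober _ (prime_filter_completely_prime P).
exists x; apply/primeFilter_inj/seteqP; split=> U /= PU.
- have : open_nbhs x (co_set U) by split=> //; exact: compactOpen_open.
  rewrite -Px => -[_ [V PV VU]].
  by apply: (pf_up (pf_prime P) PV); rewrite leEcompactOpen.
- suff [] : open_nbhs x (co_set U) by [].
  by rewrite -Px; split; [exact: compactOpen_open|exists U].
Qed.

Lemma spectral_point_homeomorphism : homeomorphism spectral_point.
Proof.
apply: homeomorphism_bij spectral_point_inj spectral_point_surj _ _.
- apply/continuousP => B oB; rewrite openE => x Bx.
  have [U Ux UB] := open_primeFilterP oB Bx.
  rewrite /interior nbhsE; exists (co_set U); last by move=> y Uy; exact: UB.
  by split=> //; exact: compactOpen_open.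
- move=> V oV; rewrite openE => _ [x Vx <-].
  have [U Ux UV] := compactOpen_basis oV Vx.
  rewrite /interior nbhsE; exists (pf_basic U).
    by split=> //; exact: open_pf_basic.
  (* By surjectivity every prime filter in [pf_basic U] comes from a point of [U], so [pf_basic U]
     lies inside the image of [V]. *)
  move=> P; have [y <-] := spectral_point_surj P => Uy.
  by exists y => //; exact: UV.
Qed.

End SpectralPoints.

Theorem theorem3p14 (X : s4dmSpectralType) :
  exists f : X -> primeFilter (compactOpen X),
    [/\ homeomorphism f,
        forall x : X, pf_set (f (dm_inv x)) = spectrum_inv (f x)
      & forall x y : X, s4_rel x y <-> spectrum_rel (f x) (f y)].
Proof.
exists spectral_point; split; first exact: spectral_point_homeomorphism.
(* [neg U] is in the filter of [x] iff [dm_inv x] is outside [U], so the two sides differ by a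
   double negation. *)
- by move=> x; apply/seteqP; split=> U /=; rewrite /spectrum_inv /= notK.
- move=> x y; split=> [xy U Ux|xy]; first by exists x.
  (* A separating [U] would be in the filter of [x] while [nabla U] is missing from that of [y],
     against [xy]. *)
  apply: contrapT => /s4_rel_sep [U [cU Ux]]; apply.
  exact: (xy (CompactOpen (introT (asboolP _) cU))).
Qed.
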